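(* As $n\to\infty$ over powers of two, the total predicates $\varphi_0$ (validity of a canonical $0$-certificate descriptor) and $\varphi_1$ (being a clean matching pair) defined in the context satisfy \[ \widetilde{\deg}(\varphi_0)=\widetilde{O}(\sqrt n)\qquad\text{and}\qquad \widetilde{\deg}(\varphi_1)=\widetilde{O}(\sqrt n). \]
   Context: Parameters. $n=2^\ell$ is a power of two, large enough that $\ell=\log_2 n\ge5$; $M:=\lfloor n^{(\ell+1)/(\ell+2)}\rfloor$ (so $1\le M<n$) and $L:=\ell n$. Fix a bijection between $\{0,1\}^\ell$ and $[n]=\{1,\dots,n\}$, so that each $\ell$-bit string names an element of $[n]$. Fix maps $r_1,\dots,r_\ell:[n]\times[n]\to[n]$ with the property (such maps exist) that for every $S\subseteq[n]$ with $|S|\le n^{(\ell+1)/(\ell+2)}$, $|\{(i,j)\in S\times S:\ r_k(i,j)\in S\ \forall k\in[\ell]\}|\le L$. Inputs. $x\in\{0,1\}^{2n^2}$ has coordinates $x_{i,j,b}$, $i,j\in[n]$, $b\in\{1,2\}$, viewed as an $n\times n$ matrix with $(i,j)$ entry $(x_{i,j,1},x_{i,j,2})$. Entries $(a_1,a_2),(b_1,b_2)$ match if $(a_1\wedge b_1)\vee(a_2\wedge b_2)=1$; two distinct rows match if their entries match in every column. A row is bad if some entry of it is $(0,0)$. An ordered pair $(i_1,i_2)$ is a clean matching pair on $x$ if $i_1\neq i_2$, rows $i_1,i_2$ of $x$ match, and none of the rows $r_1(i_1,i_2),\dots,r_\ell(i_1,i_2)$ of $x$ is bad. Membership. For a list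 $A=(a_1,\dots,a_M)\in[n]^M$ (not necessarily sorted) and $i\in[n]$, $\operatorname{mem}_A(i)\in\{0,1\}$ is the output of this search: start with $\lambda=1,\mu=M+1$; while $\lambda<\mu$, let $m=\lfloor(\lambda+\mu)/2\rfloor$, and if $a_m<i$ set $\lambda:=m+1$, else set $\mu:=m$; at the end output $1$ iff $\lambda\le M$ and $a_\lambda=i$. Descriptors and validity. A canonical $0$-certificate descriptor is a pair $(j,A)$ with $j\in[n]$, $A\in[n]^M$, encoded by $(1+M)\log n$ bits. For $u\ne v$ let $E_A(u,v)=\operatorname{mem}_A(u)\operatorname{mem}_A(v)\prod_{k=1}^\ell\operatorname{mem}_A(r_k(u,v))$, $Z_{u,v}=(1-x_{u,v,1})(1-x_{v,v,2})$, and $W(A,x)=\sum_{u\neq v}E_A(u,v)(1-Z_{u,v})$, the sum over ordered pairs of distinct $u,v\in[n]$. The descriptor $(j,A)$ is valid on $x$ if (K) for all $i\in[n]$, $\operatorname{mem}_A(i)=1$ or $(x_{i,j,1},x_{i,j,2})=(0,0)$; and (R) $W(A,x)=0$. Predicates. $\varphi_0(x,(j,A))=1$ iff $(j,A)$ is valid on $x$, a total Boolean function of $2n^2+(1+M)\log n$ bits. $\varphi_1(x,(i_1,i_2))=1$ iff $(i_1,i_2)$ is a clean matching pair on $x$, a total Boolean function of $2n^2+2\log n$ bits. For a total Boolean function $g$ on $\{0,1\}^N$, $\widetilde{\deg}(g)$ is the least degree of a real polynomial $p$ with $|p(x)-g(x)|\le1/3$ for all $x\in\{0,1\}^N$. $\widetilde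 O$ suppresses factors polylogarithmic in $n$; logarithms are base $2$. *)

(* Defs.v *)
From mathcomp Require Import all_boot all_order all_algebra.
From mathcomp Require Import boolp reals topology normedtype.
From mathcomp Require Import landau exp.
(* The notations of mpoly clash with those of MathComp-Analysis. *)
From mathcomp Require Import -(notations) mpoly.

Set Implicit Arguments.
Unset Strict Implicit.
Unset Printing Implicit Defensive.

Import Order.TTheory GRing.Theory Num.Theory.
Import numFieldNormedType.Exports.

Local Open Scope classical_set_scope.
Local Open Scope ring_scope.

(** * Approximate degree *)

Definition evalb (R : realType) (N : nat) (p : mpoly N R) (z : N.-tuple bool)
  : R := meval (fun i => (tnth z i)%:R) p.

(* [mmeasure mdeg] is multinomials' [msize]: one more than the total degree,
   and 0 for the zero polynomial, which thus gets degree 0 here.             *)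
Definition mpdeg (R : realType) (N : nat) (p : mpoly N R) : nat :=
  (mmeasure mdeg p).-1.

Definition approximates (R : realType) (N : nat) (p : mpoly N R)
    (g : N.-tuple bool -> bool) : Prop :=
  forall z : N.-tuple bool, `|evalb p z - (g z)%:R| <= 1 / 3.

Definition adeg_cand (R : realType) (N : nat) (g : N.-tuple bool -> bool) :
    pred nat :=
  fun d => `[< exists p : mpoly N R, approximates p g /\ mpdeg p = d >].

Lemma adeg_ex (R : realType) (N : nat) (g : N.-tuple bool -> bool) :
  exists d, adeg_cand R g d.
Proof.
pose lit (b : bool) (i : 'I_N) : mpoly N R :=
  if b then mpolyX R (mnm1 i) else 1 - mpolyX R (mnm1 i).
pose p : mpoly N R :=
  \sum_(y : N.-tuple bool) (g y)%:R * \prod_(i < N) lit (tnth y i) i.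
exists (mpdeg p); apply/asboolP; exists p; split=> // z.
suff -> : evalb p z = (g z)%:R by rewrite subrr normr0 divr_ge0.
have litE b i : meval (fun j => (tnth z j)%:R) (lit b i) = (b == tnth z i)%:R.
  rewrite /lit; case: b; rewrite ?mevalB ?meval1 mevalXU;
    by case: (tnth z i); rewrite /= ?subrr ?subr0.
rewrite /evalb raddf_sum (bigD1 z) //= [X in _ + X]big1 => [|y ynz].
  rewrite addr0 rmorphM rmorph_nat rmorph_prod big1 ?mulr1 // => i _.
  by rewrite /= litE eqxx.
have [i ne_i] : exists i, tnth y i != tnth z i.
  apply/existsP; apply: contraR ynz => /existsPn eq_yz.
  by apply/eqP/eq_from_tnth => i; apply/eqP; have := eq_yz i; rewrite negbK.
rewrite rmorphM rmorph_prod (bigD1 i) //= litE (negbTE ne_i).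
by rewrite mul0r mulr0.
Qed.

Definition adeg (R : realType) (N : nat) (g : N.-tuple bool -> bool) : nat :=
  ex_minn (adeg_ex R g).

(** * Asymptotics over powers of two *)

(* Both functions of n = 2 ^ ell are given as functions of ell; a
   polylogarithmic factor in n is a power of ell = log2 n.                   *)
Definition softO_pow2 (R : realType) (f g : nat -> R) : Prop :=
  exists c : nat, f =O_\oo (fun ell => g ell * ell%:R ^+ c).

(** * Parameters *)

(* n ^ ((ell + 1) / (ell + 2)) for n = 2 ^ ell. *)
Definition size_bound (R : realType) (ell : nat) : R :=
  (2 ^ ell)%N%:R `^ (ell.+1%:R / ell.+2%:R).

Definition Mpar (R : realType) (ell : nat) : nat :=
  Num.truncn (size_bound R ell).

Definition Lpar (ell : nat) : nat := (ell * 2 ^ ell)%N.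

Definition sparse_maps (R : realType) (ell : nat)
    (r : 'I_ell -> 'I_(2 ^ ell) -> 'I_(2 ^ ell) -> 'I_(2 ^ ell)) : Prop :=
  forall S : {set 'I_(2 ^ ell)}, #|S|%:R <= size_bound R ell ->
    (#|[pred p : 'I_(2 ^ ell) * 'I_(2 ^ ell) |
         [&& p.1 \in S, p.2 \in S & [forall k, r k p.1 p.2 \in S]]]|
       <= Lpar ell)%N.

(** * Clean matching pairs *)

Definition entry_match (a b : bool * bool) : bool :=
  (a.1 && b.1) || (a.2 && b.2).

Definition rows_match (n : nat) (x : 'M[bool * bool]_n) (i1 i2 : 'I_n) : bool :=
  [forall j, entry_match (x i1 j) (x i2 j)].

Definition bad_row (n : nat) (x : 'M[bool * bool]_n) (i : 'I_n) : bool :=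
  [exists j, x i j == (false, false)].

Definition clean_matching_pair (n ell : nat) (r : 'I_ell -> 'I_n -> 'I_n -> 'I_n)
    (x : 'M[bool * bool]_n) (i1 i2 : 'I_n) : bool :=
  [&& i1 != i2, rows_match x i1 i2 & [forall k, ~~ bad_row x (r k i1 i2)]].

(** * Membership by binary search *)

(* The set {1, ..., n} is represented by 'I_n (values shifted by one), but
   list positions are numbered from 1; [lam], [mu] and the midpoint are such
   positions. The default of [nth] is never reached.                         *)
Definition item (n M : nat) (A : M.-tuple 'I_n) (i : 'I_n) (m : nat) : 'I_n :=
  nth i A m.-1.

(* [mu - lam] decreases at every step, so [fuel = mu - lam] runs the loop to
   its end.                                                                  *)
Fixpoint search (n M : nat) (A : M.-tuple 'I_n) (i : 'I_n)
    (fuel lam mu : nat) : nat :=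
  if fuel is fuel'.+1 then
    if (lam < mu)%N then
      let m := ((lam + mu) %/ 2)%N in
      if (item A i m < i)%N then search A i fuel' m.+1 mu
      else search A i fuel' lam m
    else lam
  else lam.

Definition mem_search (n M : nat) (A : M.-tuple 'I_n) (i : 'I_n) : bool :=
  let lam := search A i M 1 M.+1 in (lam <= M)%N && (item A i lam == i).

(** * Validity of canonical 0-certificate descriptors *)

Definition E_term (n ell M : nat) (r : 'I_ell -> 'I_n -> 'I_n -> 'I_n)
    (A : M.-tuple 'I_n) (u v : 'I_n) : int :=
  (mem_search A u)%:R * (mem_search A v)%:R *
  \prod_(k < ell) (mem_search A (r k u v))%:R.

Definition Z_term (n : nat) (x : 'M[bool * bool]_n) (u v : 'I_n) : int :=
  (1 - (x u v).1%:R) * (1 - (x v v).2%:R).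

Definition W_sum (n ell M : nat) (r : 'I_ell -> 'I_n -> 'I_n -> 'I_n)
    (A : M.-tuple 'I_n) (x : 'M[bool * bool]_n) : int :=
  \sum_(u < n) \sum_(v < n | u != v) E_term r A u v * (1 - Z_term x u v).

Definition valid (n ell M : nat) (r : 'I_ell -> 'I_n -> 'I_n -> 'I_n)
    (x : 'M[bool * bool]_n) (j : 'I_n) (A : M.-tuple 'I_n) : bool :=
  [forall i, mem_search A i || (x i j == (false, false))] &&
  (W_sum r A x == 0).

(** * The predicates as functions on bit strings *)

(* A string of n * n * 2 + B * ell bits is a matrix x, whose bit x_{i,j,b} is
   at [xbit i j b] (with b = 1, 2 rendered as ord0, ord_max), followed by B
   blocks of ell bits, each naming an element of 'I_n through [name].        *)
Definition xbit (n m : nat) (i j : 'I_n) (b : 'I_2) : 'I_(n * n * 2 + m) :=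
  lshift m (mxvec_index (mxvec_index i j) b).

Definition decode_x (n m : nat) (z : (n * n * 2 + m).-tuple bool) :
    'M[bool * bool]_n :=
  \matrix_(i, j) (tnth z (xbit m i j ord0), tnth z (xbit m i j ord_max)).

Definition decode_block (n ell B : nat) (name : ell.-tuple bool -> 'I_n)
    (z : (n * n * 2 + B * ell).-tuple bool) (k : 'I_B) : 'I_n :=
  name [tuple tnth z (rshift (n * n * 2) (mxvec_index k t)) | t < ell].

Definition phi0 (n ell M : nat) (name : ell.-tuple bool -> 'I_n)
    (r : 'I_ell -> 'I_n -> 'I_n -> 'I_n)
    (z : (n * n * 2 + M.+1 * ell).-tuple bool) : bool :=
  valid r (decode_x z) (decode_block name z ord0)
    [tuple decode_block name z (lift ord0 k) | k < M].

Definition phi1 (n ell : nat) (name : ell.-tuple bool -> 'I_n)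
    (r : 'I_ell -> 'I_n -> 'I_n -> 'I_n)
    (z : (n * n * 2 + 2 * ell).-tuple bool) : bool :=
  clean_matching_pair r (decode_x z)
    (decode_block name z ord0) (decode_block name z ord_max).

(* Main.v *)
(* Both predicates assert that no violation occurs, where the number T of
   violations is at most K = O(n log n): for phi_0 the pairs of listed elements
   whose images under r_1, ..., r_l are all listed number at most L, since the
   list has at most n^((l+1)/(l+2)) elements. Each violation depends on
   polylogarithmically many adaptively queried bits (binary search makes
   O(log n) steps of l bits), hence is a polynomial of polylogarithmic degree,
   and so is T. Composing T with a rescaled Chebyshev polynomial of degree
   about sqrt K that is 1 at 0 and at most 1/3 in absolute value on [1, K]
   gives the approximation. *)
Require Import Defs.
From mathcomp Require Import all_boot all_order all_algebra.
From mathcomp Require Import boolp reals topology normedtype landau exp.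
From mathcomp Require Import -(notations) mpoly.
From mathcomp Require Import zify ring lra.

Set Implicit Arguments.
Unset Strict Implicit.
Unset Printing Implicit Defensive.

Import Order.TTheory GRing.Theory Num.Theory.
Import numFieldNormedType.Exports.

Local Open Scope ring_scope.

(** * Functions computed by polynomials of bounded degree *)

(** Only values at Boolean points matter, so [p] need not be multilinear. The bound is [d.+1]
    because [mmeasure mdeg] is one more than the degree. *)
Definition deg_le (R : realType) (N d : nat) (f : N.-tuple bool -> R) : Prop :=
  exists2 p : mpoly N R, forall z, evalb p z = f z & (mmeasure mdeg p <= d.+1)%N.

Lemma deg_le_ext (R : realType) (N d : nat) (f g : N.-tuple bool -> R) :
  f =1 g -> deg_le d f -> deg_le d g.
Proof. by move=> fg [p pf pd]; exists p => // z; rewrite pf fg. Qed.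

Lemma deg_leW (R : realType) (N d e : nat) (f : N.-tuple bool -> R) :
  (d <= e)%N -> deg_le d f -> deg_le e f.
Proof. by move=> de [p pf pd]; exists p => //; apply: leq_trans pd _. Qed.

Lemma deg_le_cst (R : realType) (N d : nat) (c : R) :
  deg_le d (fun _ : N.-tuple bool => c).
Proof.
exists (mpolyC N c) => [z|]; first by rewrite /evalb mevalC.
by rewrite mmeasureC; case: (c != 0).
Qed.

Lemma deg_le_bit (R : realType) (N : nat) (i : 'I_N) :
  deg_le 1 (fun z : N.-tuple bool => (tnth z i)%:R : R).
Proof.
exists (mpolyX R (mnm1 i)) => [z|]; first by rewrite /evalb mevalXU.
by rewrite mmeasureX /= mdeg1.
Qed.

Lemma deg_leD (R : realType) (N d : nat) (f g : N.-tuple bool -> R) :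
  deg_le d f -> deg_le d g -> deg_le d (fun z => f z + g z).
Proof.
move=> [p pf pd] [q qg qd]; exists (p + q) => [z|].
  by rewrite /evalb mevalD -pf -qg.
by rewrite (leq_trans (mmeasureD_le _ _ _)) // geq_max pd.
Qed.

Lemma deg_leM (R : realType) (N d e : nat) (f g : N.-tuple bool -> R) :
  deg_le d f -> deg_le e g -> deg_le (d + e) (fun z => f z * g z).
Proof.
move=> [p pf pd] [q qg qd]; exists (p * q) => [z|].
  by rewrite /evalb mevalM -pf -qg.
(* Degrees add exactly only for nonzero factors. *)
have [->|p0] := eqVneq p 0; first by rewrite mul0r mmeasure0.
have [->|q0] := eqVneq q 0; first by rewrite mulr0 mmeasure0.
rewrite msizeM //; move: pd qd.
by move: (mmeasure mdeg p) (mmeasure mdeg q) => a b; lia.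
Qed.

Lemma deg_leB (R : realType) (N d : nat) (f g : N.-tuple bool -> R) :
  deg_le d f -> deg_le d g -> deg_le d (fun z => f z - g z).
Proof.
move=> fd gd; apply: deg_leD fd _.
apply: deg_le_ext (deg_leM (deg_le_cst N 0 (-1)) gd) => z.
by rewrite mulN1r.
Qed.

Lemma deg_le_sum (R : realType) (N d : nat) (I : Type) (s : seq I)
    (f : I -> N.-tuple bool -> R) :
  (forall i, deg_le d (f i)) -> deg_le d (fun z => \sum_(i <- s) f i z).
Proof.
move=> fd; elim: s => [|i s IHs].
  by apply: deg_le_ext (deg_le_cst N d 0) => z; rewrite big_nil.
by apply: deg_le_ext (deg_leD (fd i) IHs) => z; rewrite big_cons.
Qed.

Lemma deg_le_prod (R : realType) (N d : nat) (I : Type) (s : seq I)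
    (f : I -> N.-tuple bool -> R) :
  (forall i, deg_le d (f i)) ->
  deg_le (size s * d) (fun z => \prod_(i <- s) f i z).
Proof.
move=> fd; elim: s => [|i s IHs].
  by apply: deg_le_ext (deg_le_cst N _ 1) => z; rewrite big_nil.
by apply: deg_le_ext (deg_leM (fd i) IHs) => z; rewrite big_cons.
Qed.

Definition bdeg_le (R : realType) (N d : nat) (b : N.-tuple bool -> bool) :=
  deg_le d (fun z => (b z)%:R : R).

Lemma bdeg_leN (R : realType) (N d : nat) (b : N.-tuple bool -> bool) :
  bdeg_le R d b -> bdeg_le R d (fun z => ~~ b z).
Proof.
move=> bd; apply: deg_le_ext (deg_leB (deg_le_cst N d 1) bd) => z.
by case: (b z); rewrite /= ?subrr ?subr0.
Qed.

Lemma bdeg_le_and (R : realType) (N d e : nat) (a b : N.-tuple bool -> bool) :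
  bdeg_le R d a -> bdeg_le R e b -> bdeg_le R (d + e) (fun z => a z && b z).
Proof.
by move=> ad bd; apply: deg_le_ext (deg_leM ad bd) => z; rewrite -natrM mulnb.
Qed.

Lemma bdeg_le_or (R : realType) (N d e : nat) (a b : N.-tuple bool -> bool) :
  bdeg_le R d a -> bdeg_le R e b -> bdeg_le R (d + e) (fun z => a z || b z).
Proof.
move=> ad bd.
apply: deg_le_ext (bdeg_leN (bdeg_le_and (bdeg_leN ad) (bdeg_leN bd))) => z.
by rewrite -negb_or negbK.
Qed.

Lemma bdeg_le_forall (R : realType) (N d : nat) (I : finType)
    (b : I -> N.-tuple bool -> bool) :
  (forall i, bdeg_le R d (b i)) ->
  bdeg_le R (#|I| * d) (fun z => [forall i, b i z]).
Proof.
move=> bd; rewrite cardE.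
apply: deg_le_ext (deg_le_prod (enum I) bd) => z; rewrite big_enum /=.
case: (boolP [forall i, b i z]) => [/forallP bT|/forallPn].
  by rewrite big1 // => i _; rewrite bT.
case=> i /negbTE bF.
by rewrite (bigD1 i) //= bF mul0r.
Qed.

(* Interpolation over the values of the queried bits. *)
Lemma deg_le_query (R : realType) (N l d : nat) (pos : 'I_l -> 'I_N)
    (f : l.-tuple bool -> N.-tuple bool -> R) :
  (forall s, deg_le d (f s)) ->
  deg_le (l + d) (fun z => f [tuple tnth z (pos t) | t < l] z).
Proof.
move=> fd.
pose ind (s : l.-tuple bool) (t : 'I_l) (z : N.-tuple bool) : R :=
  (tnth z (pos t) == tnth s t)%:R.
have indd s t : deg_le 1 (ind s t).
  rewrite /ind; case: (tnth s t).
    by apply: deg_le_ext (deg_le_bit R (pos t)) => z; case: (tnth z (pos t)).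
  apply: deg_le_ext (deg_leB (deg_le_cst N 1 1) (deg_le_bit R (pos t))) => z.
  by case: (tnth z (pos t)); rewrite /= ?subrr ?subr0.
(* The product is the degree-[l] indicator of the answers [s]. Summing over all answer patterns
   keeps just the true one and costs no degree. *)
have inds s : deg_le (l + d) (fun z => (\prod_(t < l) ind s t z) * f s z).
  apply: deg_leM (fd s); have := deg_le_prod (enum 'I_l) (indd s).
  rewrite size_enum_ord muln1; apply: deg_le_ext => z.
  by rewrite big_enum.
apply: deg_le_ext (deg_le_sum (index_enum (l.-tuple bool)) inds) => z.
rewrite (bigD1 [tuple tnth z (pos t) | t < l]) //= [X in _ + X]big1 => [|s ns].
  by rewrite addr0 big1 ?mul1r // => t _; rewrite /ind tnth_mktuple eqxx.
have [t nt] : exists t, tnth s t != tnth z (pos t).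
  apply/existsP; apply: contraR ns => /existsPn eq_s.
  apply/eqP/eq_from_tnth => t; rewrite tnth_mktuple; apply/eqP.
  by have := eq_s t; rewrite negbK.
by rewrite (bigD1 t) //= {1}/ind eq_sym (negbTE nt) !mul0r.
Qed.

(** * Approximating a conjunction *)

(* Pairs (T_d(y), U_(d-1)(y)) of Chebyshev polynomials. *)
Fixpoint cheb (K : comPzRingType) (y : K) (d : nat) : K * K :=
  if d is d'.+1 then
    let: (t, u) := cheb y d' in (y * t + (y ^+ 2 - 1) * u, y * u + t)
  else (1, 0).

(** The left side is the norm of T + U sqrt(y^2 - 1), and each step of the recurrence multiplies by
    y + sqrt(y^2 - 1), which has norm 1. *)
Lemma cheb_pell (K : comPzRingType) (y : K) (d : nat) :
  (cheb y d).1 ^+ 2 - (y ^+ 2 - 1) * (cheb y d).2 ^+ 2 = 1.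
Proof.
elim: d => [|d]; first by rewrite /=; ring.
by rewrite /=; case: (cheb y d) => t u /= IHd; rewrite -[RHS]IHd; ring.
Qed.

(** For such [y] the Pell identity reads T^2 + (1 - y^2) U^2 = 1 with both terms nonnegative. *)
Lemma cheb_le1 (R : realFieldType) (y : R) (d : nat) :
  -1 <= y <= 1 -> `|(cheb y d).1| <= 1.
Proof.
move=> /andP[y_ge y_le]; have := cheb_pell y d.
case: (cheb y d) => t u /= pell.
rewrite -(@expr_le1 _ 2) // real_normK ?num_real // -[leRHS]pell.
have: 0 <= (1 - y) * (1 + y) * u ^+ 2.
  by apply/mulr_ge0/sqr_ge0/mulr_ge0; lra.
nra.
Qed.

(** Quadratic growth in [d] just outside [-1, 1]. The bound on the second component is what lets the
    induction for the first go through. *)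
Lemma cheb_ge (R : realFieldType) (e : R) (d : nat) : 0 <= e ->
  1 + d%:R ^+ 2 * e <= (cheb (1 + e) d).1 /\ d%:R <= (cheb (1 + e) d).2.
Proof.
move=> e0; elim: d => [|d] /=; first by rewrite expr0n /= mul0r addr0.
case: (cheb (1 + e) d) => t u /= [tge uge]; rewrite -natr1.
have d0 : 0 <= d%:R :> R by [].
move: (d%:R) d0 tge uge => x x0 tge uge.
have h1 : 0 <= e * (u - x) by rewrite mulr_ge0 ?subr_ge0.
have h2 : 0 <= e * e * u by rewrite !mulr_ge0 // (le_trans x0).
have h3 : 0 <= e * (t - 1 - x ^+ 2 * e) by rewrite mulr_ge0 //; lra.
have h4 : 0 <= e * (x ^+ 2 * e) by rewrite !mulr_ge0 // sqr_ge0.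
have h5 : 0 <= x ^+ 2 * e by rewrite mulr_ge0 // sqr_ge0.
split; nra.
Qed.

Lemma deg_le_cheb (R : realType) (N D d : nat) (f : N.-tuple bool -> R) :
  deg_le D f -> deg_le (d * D) (fun z => (cheb (f z) d).1).
Proof.
move=> fd; suff [] : deg_le (d * D) (fun z => (cheb (f z) d).1) /\
  deg_le (d.-1 * D) (fun z => (cheb (f z) d).2) by [].
elim: d => [|d [tD uD]] /=; first by split; apply: deg_le_cst.
have uD' : deg_le (d * D) (fun z => f z * (cheb (f z) d).2).
  (* At [d = 0] the truncated [d.-1] would give degree [D] instead of 0, but there the second
     component vanishes. *)
  case: d uD {tD} => [_|d uD]; last exact: deg_leM fd uD.
  by apply: deg_le_ext (deg_le_cst N _ 0) => z; rewrite /= mulr0.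
split; last first.
  by apply: deg_le_ext (deg_leD uD' tD) => z; case: (cheb (f z) d).
have yuD : deg_le (d.+1 * D) (fun z => f z * (f z * (cheb (f z) d).2)).
  exact: deg_leM fd uD'.
have uD1 : deg_le (d.+1 * D) (fun z => (cheb (f z) d).2).
  by apply: deg_leW uD; lia.
apply: deg_le_ext (deg_leD (deg_leM fd tD) (deg_leB yuD uD1)) => z.
by case: (cheb (f z) d) => t u /=; ring.
Qed.

Lemma adeg_le (R : realType) (N d : nat) (g : N.-tuple bool -> bool)
    (f : N.-tuple bool -> R) :
  deg_le d f -> (forall z, `|f z - (g z)%:R| <= 1 / 3) -> (adeg R g <= d)%N.
Proof.
move=> [p pf pd] fg; rewrite /adeg; case: ex_minnP => m _ /(_ (mpdeg p)) m_le.
apply: (@leq_trans (mpdeg p)); last by rewrite /mpdeg; lia.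
by apply/m_le/asboolP; exists p; split=> // z; rewrite pf.
Qed.

(* The number T of violated conjuncts lies in [0, K], and t |-> 1 - 2 (t - 1) / K
   maps [1, K] into [-1, 1] and 0 to 1 + 2 / K, where T_d is at least 3. *)
Lemma adeg_forall_le (R : realType) (N D K d : nat) (I : finType)
    (b : I -> N.-tuple bool -> bool) (g : N.-tuple bool -> bool) :
  (forall i, bdeg_le R D (b i)) ->
  (forall z, \sum_i b i z <= K)%N ->
  (forall z, g z = [forall i, ~~ b i z]) ->
  (0 < K <= d ^ 2)%N ->
  (adeg R g <= d * D)%N.
Proof.
move=> bD bK gE /andP[K0 Kd].
pose T (z : N.-tuple bool) : R := \sum_i (b i z)%:R.
pose y z := 1 - 2 / K%:R * (T z - 1).
have K0R : 0 < K%:R :> R by rewrite ltr0n.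
have yD : deg_le D y.
  have TD : deg_le D T by apply: deg_le_sum.
  apply: deg_leB (deg_le_cst _ _ _) _.
  exact: deg_leM (deg_le_cst N 0 _) (deg_leB TD (deg_le_cst _ _ _)).
pose q0 : R := (cheb (1 + 2 / K%:R) d).1.
(* With e = 2 / K and K <= d^2, the lower bound 1 + d^2 e is at least 3. *)
have q0_ge : 3 <= q0.
  have [|+ _] := @cheb_ge R (2 / K%:R) d; first by rewrite divr_ge0 ?ltW.
  apply: le_trans; suff: 2 <= d%:R ^+ 2 * (2 / K%:R) :> R by lra.
  rewrite mulrA ler_pdivlMr // mulrC ler_pM2r //.
  by rewrite -natrX ler_nat.
apply: (@adeg_le R _ _ _ (fun z => q0^-1 * (cheb (y z) d).1)) => [|z].
  exact: deg_leM (deg_le_cst N 0 _) (deg_le_cheb d yD).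
have TE : T z = (\sum_i b i z)%N%:R by rewrite natr_sum.
have q0_gt : 0 < q0 by lra.
case: (posnP (\sum_i b i z)%N) => [T0|T_gt].
  have -> : g z = true.
    rewrite gE; apply/forallP => i; move/eqP: T0; rewrite sum_nat_eq0.
    by move=> /forallP /(_ i) /=; case: (b i z).
  rewrite /y TE T0 sub0r mulrN1 opprK mulVf ?gt_eqF // subrr normr0.
  by rewrite divr_ge0.
have -> : g z = false.
  rewrite gE; apply/forallP => bF; move: T_gt.
  by rewrite big1 // => i _; rewrite (negbTE (bF i)).
have T1 : 1 <= T z by rewrite TE ler1n.
have TK : T z <= K%:R by rewrite TE ler_nat.
have q0V_ge : 0 <= q0^-1 by rewrite invr_ge0 ltW.
rewrite subr0 normrM (ger0_norm q0V_ge) [leLHS]mulrC ler_pdivrMr //.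
(* A Chebyshev value of absolute value at most 1 suffices, since [q0] is at least 3. *)
apply: (@le_trans _ _ 1); last by lra.
apply: cheb_le1; rewrite /y.
have h0 : 0 <= 2 / K%:R * (T z - 1).
  by rewrite mulr_ge0 ?divr_ge0 ?subr_ge0 // ltW.
have h1 : 2 / K%:R * (T z - 1) <= 2.
  by rewrite mulrAC ler_pdivrMr // ler_pM2l //; lra.
by apply/andP; split; lra.
Qed.

(** * Queries to the input *)

(** An adaptive query: what is evaluated next may depend on the element just read, at an additive
    cost of [l]. *)
Lemma deg_le_block (R : realType) (n l B d : nat) (name : l.-tuple bool -> 'I_n)
    (k : 'I_B) (f : 'I_n -> (n * n * 2 + B * l).-tuple bool -> R) :
  (forall a, deg_le d (f a)) ->
  deg_le (l + d) (fun z => f (decode_block name z k) z).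
Proof. by move=> fd; apply: (deg_le_query _ (fun s => fd (name s))). Qed.

Lemma bdeg_le_fst (R : realType) (n m : nat) (i j : 'I_n) :
  bdeg_le R 1 (fun z => (decode_x (m := m) z i j).1).
Proof. by apply: deg_le_ext (deg_le_bit R (xbit m i j ord0)) => z; rewrite mxE. Qed.

Lemma bdeg_le_snd (R : realType) (n m : nat) (i j : 'I_n) :
  bdeg_le R 1 (fun z => (decode_x (m := m) z i j).2).
Proof.
by apply: deg_le_ext (deg_le_bit R (xbit m i j ord_max)) => z; rewrite mxE.
Qed.

Lemma bdeg_le_zero_entry (R : realType) (n m : nat) (i j : 'I_n) :
  bdeg_le R 2 (fun z => decode_x (m := m) z i j == (false, false)).
Proof.
apply: deg_le_ext (bdeg_le_and (bdeg_leN (bdeg_le_fst R m i j))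
  (bdeg_leN (bdeg_le_snd R m i j))) => z.
by case: (decode_x z i j) => -[] [].
Qed.

Lemma bdeg_le_entry_match (R : realType) (n m : nat) (i1 i2 j : 'I_n) :
  bdeg_le R 4
    (fun z => entry_match (decode_x (m := m) z i1 j) (decode_x z i2 j)).
Proof.
exact: (bdeg_le_or
  (bdeg_le_and (bdeg_le_fst R m i1 j) (bdeg_le_fst R m i2 j))
  (bdeg_le_and (bdeg_le_snd R m i1 j) (bdeg_le_snd R m i2 j))).
Qed.

(** * Clean matching pairs *)

(** Badness of a row is split over its columns, so that each violation inspects boundedly many
    matrix bits once the two indices are known. *)
Definition clean_violation (n l : nat) (r : 'I_l -> 'I_n -> 'I_n -> 'I_n)
    (x : 'M[bool * bool]_n) (i1 i2 : 'I_n) (c : option ('I_n + 'I_l * 'I_n)) :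
    bool :=
  match c with
  | None => i1 == i2
  | Some (inl j) => ~~ entry_match (x i1 j) (x i2 j)
  | Some (inr (k, j)) => x (r k i1 i2) j == (false, false)
  end.

Lemma clean_matching_pairE (n l : nat) (r : 'I_l -> 'I_n -> 'I_n -> 'I_n)
    (x : 'M[bool * bool]_n) (i1 i2 : 'I_n) :
  clean_matching_pair r x i1 i2 = [forall c, ~~ clean_violation r x i1 i2 c].
Proof.
apply/and3P/forallP => [[ne /forallP match12 /forallP clean] c|noviol].
  case: c => [[j|[k j]]|] //=; first by rewrite negbK.
  by have /existsPn := clean k; apply.
split; first exact: (noviol None).
- by apply/forallP => j; have := noviol (Some (inl j)); rewrite /= negbK.
- by apply/forallP => k; apply/existsPn => j; apply: (noviol (Some (inr (k, j)))).
Qed.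

(** Reading each index costs [l] and comparing two entries at most 4. The number of violations is
    bounded by the number of conjuncts, the extra one being [i1 == i2]. *)
Lemma adeg_phi1_le (R : realType) (n l d : nat) (name : l.-tuple bool -> 'I_n)
    (r : 'I_l -> 'I_n -> 'I_n -> 'I_n) :
  ((n + l * n).+1 <= d ^ 2)%N ->
  (adeg R (phi1 name r) <= d * (l + (l + 4)))%N.
Proof.
move=> nd; apply: (@adeg_forall_le _ _ _ (n + l * n).+1 _
  (option ('I_n + 'I_l * 'I_n))
  (fun c z => clean_violation r (decode_x z) (decode_block name z ord0)
     (decode_block name z ord_max) c)) => //.
- move=> c; rewrite /bdeg_le.
  apply: (deg_le_block name ord0 (f := fun i1 z => (clean_violation r
    (decode_x z) i1 (decode_block name z ord_max) c)%:R)) => i1.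
  apply: (deg_le_block name ord_max (f := fun i2 z => (clean_violation r
    (decode_x z) i1 i2 c)%:R)) => i2.
  case: c => [[j|[k j]]|]; last exact: deg_le_cst.
    exact: bdeg_leN (bdeg_le_entry_match R _ _ _ _).
  exact: deg_leW (bdeg_le_zero_entry R _ _ _).
- move=> z; apply: leq_trans (_ : #|{: option ('I_n + 'I_l * 'I_n)}| <= _)%N.
    by rewrite -sum1_card; apply: leq_sum => c _; apply: leq_b1.
  by rewrite card_option card_sum card_prod !card_ord.
- by move=> z; apply: clean_matching_pairE.
Qed.

(** * Membership by binary search *)

Definition decode_list (n M l : nat) (name : l.-tuple bool -> 'I_n)
    (z : (n * n * 2 + M.+1 * l).-tuple bool) : M.-tuple 'I_n :=
  [tuple decode_block name z (lift ord0 k) | k < M].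

Lemma deg_le_item (R : realType) (n M l d : nat) (name : l.-tuple bool -> 'I_n)
    (i : 'I_n) (m : nat)
    (f : 'I_n -> (n * n * 2 + M.+1 * l).-tuple bool -> R) :
  (forall a, deg_le d (f a)) ->
  deg_le (l + d)
    (fun z => f (item (decode_list name z) i m) z).
Proof.
move=> fd; case: (ltnP m.-1 M) => mM.
  apply: deg_le_ext (deg_le_block name (lift ord0 (Ordinal mM)) fd) => z.
  by rewrite /item -[m.-1]/(val (Ordinal mM)) nth_mktuple.
(* Beyond the end of the list [item] is the default [i], and no bit is read. *)
apply: deg_le_ext (deg_leW (leq_addl l d) (fd i)) => z.
by rewrite /item nth_default ?size_tuple.
Qed.

(** Every step reads one element and halves the gap, so [s] bounds the number of steps whatever the
    fuel. The continuation [f] allows further queries at the final position. *)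
Lemma deg_le_search (R : realType) (n M l d s fuel lam mu : nat)
    (name : l.-tuple bool -> 'I_n) (i : 'I_n)
    (f : nat -> (n * n * 2 + M.+1 * l).-tuple bool -> R) :
  (forall a, deg_le d (f a)) -> (mu - lam < 2 ^ s)%N ->
  deg_le (s * l + d)
    (fun z => f (search (decode_list name z) i fuel lam mu) z).
Proof.
move=> fd; elim: fuel s lam mu => [|fuel IHfuel] s lam mu gap /=.
  exact: deg_leW (leq_addl _ _) (fd lam).
case: (ltnP lam mu) => [lt_lm|_]; last exact: deg_leW (leq_addl _ _) (fd lam).
case: s gap => [|s] gap; first by move: gap; rewrite expn0; lia.
set m := ((lam + mu) %/ 2)%N.
have gapS : (mu - lam < 2 * 2 ^ s)%N by rewrite -expnS.
have gap1 : (mu - m.+1 < 2 ^ s)%N.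
  by rewrite /m; move: (2 ^ s)%N gapS => x; lia.
have gap2 : (m - lam < 2 ^ s)%N.
  by rewrite /m; move: (2 ^ s)%N gapS => x; lia.
have -> : (s.+1 * l + d = l + (s * l + d))%N by lia.
pose g (a : 'I_n) (z : (n * n * 2 + M.+1 * l).-tuple bool) :=
  f (if (a < i)%N then search (decode_list name z) i fuel m.+1 mu
     else search (decode_list name z) i fuel lam m) z.
have gd a : deg_le (s * l + d) (g a).
  by rewrite /g; case: (a < i)%N; apply: IHfuel.
by have := deg_le_item name i m gd.
Qed.

(** The initial gap is [M], hence at most [s] steps; the last [l] pays for the final equality
    test. *)
Lemma bdeg_le_mem_search (R : realType) (n M l s : nat)
    (name : l.-tuple bool -> 'I_n) (i : 'I_n) :
  (M < 2 ^ s)%N ->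
  bdeg_le R (s * l + l) (fun z : (n * n * 2 + M.+1 * l).-tuple bool =>
    mem_search (decode_list name z) i).
Proof.
move=> Ms; rewrite /bdeg_le /mem_search.
apply: (deg_le_search M name i (f := fun lam z => ((lam <= M)%N &&
  (item (decode_list name z) i lam == i))%:R)).
  move=> lam; rewrite -[l in deg_le l]addn0.
  apply: (deg_le_item name i lam (f := fun a z => ((lam <= M)%N && (a == i))%:R)).
  by move=> a; apply: deg_le_cst.
by rewrite subn1.
Qed.

(** Started at position 1, the search cannot end at 0, so a final position at most [M] is a genuine
    one. *)
Lemma search_ge (n M : nat) (A : M.-tuple 'I_n) (i : 'I_n) (fuel lam mu : nat) :
  (lam <= search A i fuel lam mu)%N.
Proof.
elim: fuel lam mu => [|fuel IHfuel] lam mu //=.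
case: ifP => // lt_lm; case: ifP => // _.
by apply: leq_trans (IHfuel _ _); lia.
Qed.

(** The search ends by testing the element it reached, so a positive answer is sound even on an
    unsorted list. *)
Lemma mem_search_mem (n M : nat) (A : M.-tuple 'I_n) (i : 'I_n) :
  mem_search A i -> i \in A.
Proof.
rewrite /mem_search => /andP[le_M /eqP {1}<-].
by apply: mem_nth; rewrite size_tuple; have := search_ge A i M 1 M.+1; lia.
Qed.

Lemma card_mem_search (n M : nat) (A : M.-tuple 'I_n) :
  (#|[set i | mem_search A i]| <= M)%N.
Proof.
rewrite -[leqRHS](size_tuple A); apply: leq_trans (card_size A).
by apply/subset_leq_card/subsetP => i; rewrite inE; apply: mem_search_mem.
Qed.

(** * Canonical 0-certificate descriptors *)

Definition cert_violation (n l M : nat) (r : 'I_l -> 'I_n -> 'I_n -> 'I_n)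
    (x : 'M[bool * bool]_n) (j : 'I_n) (A : M.-tuple 'I_n)
    (c : 'I_n + 'I_n * 'I_n) : bool :=
  match c with
  | inl i => ~~ (mem_search A i || (x i j == (false, false)))
  | inr (u, v) =>
      [&& u != v, mem_search A u, mem_search A v,
          [forall k, mem_search A (r k u v)] & (x u v).1 || (x v v).2]
  end.

(** All factors of a summand are 0 or 1, and 1 - Z is the disjunction of its two bits. Hence W
    counts violations and vanishes exactly when there are none. *)
Lemma W_sumE (n l M : nat) (r : 'I_l -> 'I_n -> 'I_n -> 'I_n)
    (x : 'M[bool * bool]_n) (j : 'I_n) (A : M.-tuple 'I_n) :
  W_sum r A x = (\sum_(p : 'I_n * 'I_n) cert_violation r x j A (inr p))%N%:R.
Proof.
pose b u v : int := (cert_violation r x j A (inr (u, v)))%:R.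
rewrite natr_sum (eq_bigr (fun p => b p.1 p.2)); last by case.
rewrite -(pair_bigA _ b) /=.
apply: eq_bigr => u _; rewrite big_mkcond /=; apply: eq_bigr => v _.
rewrite /b /=; case: (u != v) => //=; rewrite /E_term /Z_term.
have -> : \prod_(k < l) (mem_search A (r k u v))%:R =
    [forall k, mem_search A (r k u v)]%:R :> int.
  case: (boolP [forall k, _]) => [/forallP bT|/forallPn].
    by rewrite big1 // => k _; rewrite bT.
  by case=> k /negbTE bF; rewrite (bigD1 k) //= bF mul0r.
by case: (mem_search A u); case: (mem_search A v);
  case: [forall k, mem_search A (r k u v)]; case: (x u v).1; case: (x v v).2.
Qed.

Lemma validE (n l M : nat) (r : 'I_l -> 'I_n -> 'I_n -> 'I_n)
    (x : 'M[bool * bool]_n) (j : 'I_n) (A : M.-tuple 'I_n) :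
  valid r x j A = [forall c, ~~ cert_violation r x j A c].
Proof.
rewrite /valid (W_sumE r x j A) pnatr_eq0 sum_nat_eq0.
apply/andP/forallP => [[/forallP colOK /forallP pairOK] c|noviol].
  case: c => [i|p]; first by rewrite /= negbK.
  by have := pairOK p; rewrite eqb0.
split; apply/forallP => c.
  by have := noviol (inl c); rewrite /= negbK.
by rewrite eqb0; apply: (noviol (inr c)).
Qed.

(** There are at most n column violations. The violating pairs all lie in S x S with images in S,
    where S is the set of indices the search accepts; as S has at most M elements, sparsity leaves
    at most L such pairs out of the possible n^2. *)
Lemma sum_cert_violation_le (R : realType) (l : nat)
    (r : 'I_l -> 'I_(2 ^ l) -> 'I_(2 ^ l) -> 'I_(2 ^ l))
    (x : 'M[bool * bool]_(2 ^ l)) (j : 'I_(2 ^ l))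
    (A : (Mpar R l).-tuple 'I_(2 ^ l)) :
  sparse_maps R r ->
  (\sum_c cert_violation r x j A c <= 2 ^ l + Lpar l)%N.
Proof.
move=> r_sparse; rewrite big_sumType leq_add //=.
  rewrite -[leqRHS](card_ord (2 ^ l)) -sum1_card.
  by apply: leq_sum => i _; apply: leq_b1.
pose S := [set i | mem_search A i].
have S_le : #|S|%:R <= size_bound R l.
  apply: le_trans (_ : (Mpar R l)%:R <= _).
    by rewrite ler_nat card_mem_search.
  by rewrite truncn_le powR_ge0.
apply: leq_trans (r_sparse S S_le); rewrite -sum1_card [leqRHS]big_mkcond /=.
apply: leq_sum => -[u v] _; rewrite !inE /=.
case: (mem_search A u); case: (mem_search A v); rewrite ?andbF //=.
case: (boolP [forall k, _]) => [/forallP memr|_]; last by rewrite andbF.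
suff -> : [forall k, r k u v \in S] by apply: leq_b1.
by apply/forallP => k; rewrite inE.
Qed.

(** The exponent is below 1 and the base at least 1. It follows that l + 1 steps of binary search
    suffice. *)
Lemma Mpar_le (R : realType) (l : nat) : (Mpar R l <= 2 ^ l)%N.
Proof.
rewrite -(ler_nat R); apply: (@le_trans _ _ (size_bound R l)).
  by rewrite truncn_le powR_ge0.
rewrite /size_bound ler1_powR //; first by rewrite ler1n expn_gt0.
by rewrite ler_pdivrMr // mul1r ler_nat.
Qed.

(** A pair violation makes l + 2 membership tests, each of degree (l + 1) l + l, and looks at two
    bits of the matrix. *)
Lemma adeg_phi0_le (R : realType) (l d : nat)
    (name : l.-tuple bool -> 'I_(2 ^ l))
    (r : 'I_l -> 'I_(2 ^ l) -> 'I_(2 ^ l) -> 'I_(2 ^ l)) :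
  sparse_maps R r -> (2 ^ l + l * 2 ^ l < d ^ 2)%N ->
  (adeg R (phi0 (M := Mpar R l) name r)
    <= d * ((l + 2) * (l.+1 * l + l) + 2))%N.
Proof.
move=> r_sparse nd; apply: (@adeg_forall_le _ _ _ (2 ^ l + Lpar l) _
  ('I_(2 ^ l) + 'I_(2 ^ l) * 'I_(2 ^ l))%type
  (fun c z => cert_violation r (decode_x z) (decode_block name z ord0)
    (decode_list name z) c)).
- have memd i : bdeg_le R (l.+1 * l + l)
      (fun z : (2 ^ l * 2 ^ l * 2 + (Mpar R l).+1 * l).-tuple bool =>
         mem_search (decode_list name z) i).
    apply: bdeg_le_mem_search; apply: leq_ltn_trans (Mpar_le R l) _.
    by rewrite ltn_exp2l.
  set m := (l.+1 * l + l)%N in memd *.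
  have lm : (l <= m)%N by rewrite leq_addl.
  case=> [i|[u v]].
    apply: (@deg_leW _ _ (l + (m + 2))); first by nia.
    apply: (deg_le_block name ord0 (f := fun j z =>
      (cert_violation r (decode_x z) j (decode_list name z) (inl i))%:R)) => j.
    exact: bdeg_leN (bdeg_le_or (memd i) (bdeg_le_zero_entry R _ _ _)).
  rewrite /bdeg_le /=; case: (u != v) => /=; last exact: deg_le_cst.
  have := bdeg_le_forall (fun k => memd (r k u v)); rewrite card_ord => allmem.
  apply: deg_leW (bdeg_le_and (memd u) (bdeg_le_and (memd v) (bdeg_le_and allmem
    (bdeg_le_or (bdeg_le_fst R _ u v) (bdeg_le_snd R _ v v))))).
  by lia.
- by move=> z; apply: sum_cert_violation_le.
- by move=> z; apply: validE.
- by rewrite addn_gt0 expn_gt0 /= ltnW.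
Qed.

(** * Asymptotics *)

(** Taking d <= 4 l sqrt n gives 4 l times 11 l^3, that is 44 l^4, as the factor of sqrt n. The
    strict inequality on d^2 leaves room for the one extra conjunct of [phi1]. *)
Lemma softO_pow2_of_sqrt (R : realType) (a : nat -> nat) :
  (forall l d, (5 <= l)%N -> (2 ^ l + l * 2 ^ l < d ^ 2)%N ->
    (a l <= d * (11 * l ^ 3))%N) ->
  softO_pow2 (fun l => (a l)%:R) (fun l => Num.sqrt (2 ^ l)%N%:R : R).
Proof.
move=> a_le; exists 4; apply/eqO_exP; exists 44 => //.
near=> l; have l5 : (5 <= l)%N by near: l; exact: nbhs_infty_ge.
(* This K exceeds n + l n and has the explicit square root 2 l sqrt n; the loss is only
   polylogarithmic. *)
pose n := (2 ^ l)%N; pose K : R := (4 * l ^ 2 * n)%N%:R.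
have n0 : (0 < n)%N by rewrite expn_gt0.
pose d := (Num.truncn (Num.sqrt K)).+1.
have K0 : 0 <= K by rewrite ler0n.
have K1 : 1 <= Num.sqrt K.
  by rewrite -[leLHS]sqrtr1 ler_sqrt // ler1n; nia.
have d_gt : Num.sqrt K < d%:R by apply: truncnS_gt.
have d_le : d%:R <= 2 * Num.sqrt K.
  have : (Num.truncn (Num.sqrt K))%:R <= Num.sqrt K.
    by rewrite truncn_le sqrtr_ge0.
  rewrite (_ : d%:R = (Num.truncn (Num.sqrt K))%:R + 1); last by rewrite natr1.
  by move: (_%:R) K1 => t; lra.
have nd : (n + l * n < d ^ 2)%N.
  apply: (@leq_trans (4 * l ^ 2 * n).+1); first by rewrite ltnS; nia.
  rewrite -(ltr_nat R) natrX -[X in X < _](sqr_sqrtr K0).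
  by rewrite ltr_pXn2r // nnegrE ?sqrtr_ge0.
have sqrtK : Num.sqrt K = 2 * l%:R * Num.sqrt n%:R.
  rewrite /K natrM sqrtrM ?ler0n // -[(4 * _)%N]/(2 ^ 2 * _)%N -expnMn natrX.
  by rewrite sqrtr_sqr ger0_norm ?ler0n // natrM.
rewrite ger0_norm // ger0_norm; last by rewrite mulr_ge0 ?sqrtr_ge0 ?exprn_ge0.
have := a_le l d l5 nd; rewrite -(ler_nat R) => /le_trans; apply.
rewrite natrM; apply: le_trans (ler_wpM2r _ d_le) _; first exact: ler0n.
by rewrite sqrtK natrM natrX -/n le_eqVlt; apply/orP; left; apply/eqP; ring.
Unshelve. all: by end_near.
Qed.

Theorem lemma4p1 (R : realType)
    (name : forall ell : nat, ell.-tuple bool -> 'I_(2 ^ ell))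
    (r : forall ell : nat,
       'I_ell -> 'I_(2 ^ ell) -> 'I_(2 ^ ell) -> 'I_(2 ^ ell))
    (name_bij : forall ell : nat, (5 <= ell)%N -> bijective (name ell))
    (r_sparse : forall ell : nat, (5 <= ell)%N -> sparse_maps R (r ell)) :
  softO_pow2
    (fun ell => (adeg R (phi0 (M := Mpar R ell) (name ell) (r ell)))%:R)
    (fun ell => Num.sqrt (2 ^ ell)%N%:R : R)
  /\
  softO_pow2
    (fun ell => (adeg R (phi1 (name ell) (r ell)))%:R)
    (fun ell => Num.sqrt (2 ^ ell)%N%:R : R).
Proof.
split; apply: softO_pow2_of_sqrt => l d l5 nd.
  apply: leq_trans (adeg_phi0_le _ (r_sparse l l5) nd) _.
  (* The second factor expands to l^3 + 4 l^2 + 4 l + 2, whose coefficients sum to 11. *)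
  by rewrite leq_mul2l; apply/orP; right; nia.
apply: leq_trans (adeg_phi1_le R _ _ nd) _.
by rewrite leq_mul2l; apply/orP; right; nia.
Qed.
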